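(* Let $X$ be a finite index set, $K\subset X$, and let $M\in\mathbb{C}^{X\times X}$ and $H\in\mathbb{C}^{K\times K}$ be normal matrices with spectral decompositions $M=\sum_{i=1}^d\theta_iE_i$ and $H=\sum_{j=1}^r\rho_jF_j$. The following are equivalent: 1. $K$ is $H$-cospectral in $M$. 2. $H\widetilde{M^k}=\widetilde{M^k}H$ for all $k\geq 0$. 3. $H\tilde{E_i}=\tilde{E_i}H$ for all $i$. 4. $F_j\tilde{E_i}=\tilde{E_i}F_j$ for all $i,j$. 5. For any eigenvectors $v,w$ of $H$ belonging to different eigenvalues, $\langle\tilde{E_i}v,w\rangle=0$ for all $i$. 6. For each $i$ there is an orthonormal basis of $\operatorname{Im}E_i$ that, for each $j$, contains exactly $\dim\{E_i\hat v: v\in\operatorname{Im}F_j\}$ vectors $\psi$ satisfying $0\ne\tilde\psi\in\operatorname{Im}F_j$, and whose remaining elements satisfy $\tilde\psi=0$. 7. For any eigenvectors $v,w$ of $H$ belonging to different eigenvalues, the subspaces spanned by $\{M^k\hat v:k=0,1,\dots\}$ and by $\{M^k\hat w:k=0,1,\dots\}$ are orthogonal.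
   Context: $\mathbb{C}^X$ and $\mathbb{C}^K$ carry the Hermitian scalar product $\langle v,w\rangle=v^*w$. For $v\in\mathbb{C}^X$, $\tilde v=v_K\in\mathbb{C}^K$ is its restriction to $K$; for $A\in\mathbb{C}^{X\times X}$, $\tilde A=A_{K\times K}$ is its $K\times K$ submatrix. For $v\in\mathbb{C}^K$, $\hat v\in\mathbb{C}^X$ is its extension by $0$ to the coordinates in $X\setminus K$. In the spectral decompositions the $\theta_i$ (resp. $\rho_j$) are the distinct eigenvalues and $E_i$ (resp. $F_j$) the orthogonal (self-adjoint) projections onto the corresponding eigenspaces. $K$ is $H$-cospectral in $M$ if there is an orthonormal basis $\psi_1,\dots,\psi_{|X|}$ of $\mathbb{C}^X$ consisting of eigenvectors of $M$ such that each $\tilde{\psi_j}$ is either $0$ or an eigenvector of $H$. *)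

(* Defs.v *)
(* The theorem takes C = R[i] over an arbitrary realType R. *)
From HB Require Import structures.
From mathcomp Require Export all_boot all_order all_algebra.
From mathcomp Require Export complex reals.

Set Implicit Arguments.
Unset Strict Implicit.
Unset Printing Implicit Defensive.

Import GRing.Theory.
Local Open Scope ring_scope.
Local Open Scope sesquilinear_scope.

Section ColumnVectors.
Variable C : numClosedFieldType.

(* Conjugate-linear in the first argument (the library's dotmx acts on rows and
   is conjugate-linear in the second one). *)
Definition cdot n (v w : 'cV[C]_n) : C := (v ^t* *m w) 0 0.

(* Left multiplication on columns: the matrix spaces and eigenspace of
   mxalgebra are row spaces and left eigenspaces, so the image and the
   eigenspaces of a matrix acting on columns go through this map. *)
Definition mulfun m n (A : 'M[C]_(m, n)) : 'Hom('cV[C]_n, 'cV[C]_m) :=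
  linfun (mulmx A).

Definition mximage m n (A : 'M[C]_(m, n)) : {vspace 'cV[C]_m} :=
  limg (mulfun A).

Definition is_eigenvector n (A : 'M[C]_n) (a : C) (v : 'cV[C]_n) : Prop :=
  v != 0 /\ A *m v = a *: v.

Definition orthonormal_basis n (U : {vspace 'cV[C]_n}) (s : seq 'cV[C]_n) :
    Prop :=
  basis_of U s /\
  forall i j, (i < size s)%N -> (j < size s)%N -> cdot s`_i s`_j = (i == j)%:R.

Record spectral_decomposition n (A : 'M[C]_n) d (theta : 'I_d -> C)
    (E : 'I_d -> 'M[C]_n) : Prop := SpectralDecomposition {
  spectral_inj : injective theta;
  spectral_eigenvalue :
    forall a, passmx.leigenvalue (mulfun A) a <-> exists i, theta i = a;
  spectral_image :
    forall i, mximage (E i) = passmx.leigenspace (mulfun A) (theta i);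
  spectral_idem : forall i, E i *m E i = E i;
  spectral_selfadj : forall i, (E i) ^t* = E i;
  spectral_sum : A = \sum_i theta i *: E i }.

(* The span of the A^k v, k >= 0: each of its elements is a combination of
   finitely many of them. *)
Definition in_krylov n (A : 'M[C]_n) (v x : 'cV[C]_n) : Prop :=
  exists N, x \in <<mkseq (fun k => A ^+ k *m v) N>>%VS.

End ColumnVectors.

Section Restriction.
(* C^X is 'cV_n and C^K is 'cV_#|K|, the k-th coordinate of the latter being
   that of the k-th element enum_val k of K. *)
Variables (C : numClosedFieldType) (n : nat) (K : {set 'I_n}).

Definition restrict (v : 'cV[C]_n) : 'cV[C]_#|K| :=
  \col_(k < #|K|) v (enum_val k) 0.

Definition restrict_mx (A : 'M[C]_n) : 'M[C]_#|K| :=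
  \matrix_(k < #|K|, l < #|K|) A (enum_val k) (enum_val l).

Definition extend (v : 'cV[C]_#|K|) : 'cV[C]_n :=
  \col_(x < n) oapp (fun k => v k 0) 0 [pick k : 'I_#|K| | enum_val k == x].

Fact extend_is_linear : linear extend.
Proof.
move=> a u v; apply/colP=> x; rewrite !mxE.
by case: pickP => [k _|_] /=; rewrite ?mxE // mulr0 addr0.
Qed.

HB.instance Definition _ := GRing.isLinear.Build C _ _ _ extend extend_is_linear.

Fact extend_enum_val (v : 'cV[C]_#|K|) (k : 'I_#|K|) :
  extend v (enum_val k) 0 = v k 0.
Proof.
rewrite mxE; case: pickP => [l /eqP/enum_val_inj -> //|/(_ k)].
by rewrite eqxx.
Qed.

Fact extend_notin (v : 'cV[C]_#|K|) (x : 'I_n) : x \notin K -> extend v x 0 = 0.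
Proof.
move=> xK; rewrite mxE; case: pickP => [k /eqP kx|//].
by rewrite -kx enum_valP in xK.
Qed.

Definition cospectral (H : 'M[C]_#|K|) (M : 'M[C]_n) : Prop :=
  exists2 s : seq 'cV[C]_n, orthonormal_basis fullv s &
    forall psi, psi \in s ->
      (exists a, is_eigenvector M a psi) /\
      (restrict psi = 0 \/ exists b, is_eigenvector H b (restrict psi)).

End Restriction.

Arguments restrict {C n} K v.
Arguments restrict_mx {C n} K A.
Arguments extend {C n} K v.
Arguments cospectral {C n} K H M.

(* Main.v *)
Require Import Defs.

(** Write [~A] for [restrict_mx K A] and [J] for the isometric inclusion of C^K
    in C^X, so that [~A = J^* A J].  Two facts tie the seven conditions together.

    The first is that everything depends on [M] through its eigenprojections.
    The [E i] are polynomials in [M] (Lagrange interpolation,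
    [spectral_proj_poly]) and the powers of [M] are combinations of the [E i]
    ([spectral_exp]); both relations survive [A |-> ~A], which is linear.  They
    also show that the Krylov spaces of [x] and [y] are orthogonal exactly when
    [<E i x, y> = 0] for all [i] ([krylov_orth], [krylov_orth_proj]), and for
    [x], [y] extended from K this number is [<~(E i) v, w>]
    ([cdot_restrict_proj]).  On the side of [H], commuting with [H] is the same
    as commuting with every [F j] ([spectral_commP]), that is, as having no
    blocks between different eigenspaces of [H], which is the condition on pairs
    of eigenvectors ([eigen_orth_comm_proj]).

    The second is that an orthogonal projection is the sum of the rank one
    projections [psi psi^*] over an orthonormal basis of its image
    ([proj_sum_outer]).  Restriction turns [psi psi^*] into [~psi ~psi^*], which
    commutes with the normal matrix [H] as soon as [~psi] is zero or an
    eigenvector ([restrict_outer_comm]).  So an adapted basis, whether of one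
    [Im (E i)] or of the whole space, forces the commutation relations.

    Conversely, fix [i] and let [U j] be the space of the [E i v], with [v] in
    [Im (F j)] extended by zero.  Since [<E i v, E i w> = <~(E i) v, w>], the
    condition on eigenvectors says that the [U j] are pairwise orthogonal, and
    commutation says that restriction sends [U j] into [Im (F j)]; it does so
    injectively because [|E i v|^2 = <v, ~(E i v)>].  By the same adjunction, a
    vector of [Im (E i)] orthogonal to every [U j] restricts to zero.  Hence
    orthonormal bases of the [U j], completed to one of [Im (E i)], have the
    required shape ([adapted_basis]), and putting these together over all [i]
    gives a cospectral basis ([adapted_basis_cospectral]). *)

Set Implicit Arguments.
Unset Strict Implicit.
Unset Printing Implicit Defensive.

Import Order.TTheory GRing.Theory Num.Theory.
Local Open Scope ring_scope.
Local Open Scope sesquilinear_scope.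

(** * Adjoints and the scalar product *)

Section ScalarProduct.
Variable C : numClosedFieldType.

Lemma adjM m n p (A : 'M[C]_(m, n)) (B : 'M_(n, p)) :
  (A *m B)^t* = B^t* *m A^t*.
Proof. by rewrite trmx_mul map_mxM. Qed.

Lemma adjZ m n (a : C) (A : 'M[C]_(m, n)) : (a *: A)^t* = a^* *: A^t*.
Proof. by rewrite linearZ /= map_mxZ. Qed.

Lemma adj_sum m n (I : Type) (s : seq I) (A : I -> 'M[C]_(m, n)) :
  (\sum_(i <- s) A i)^t* = \sum_(i <- s) (A i)^t*.
Proof. by rewrite linear_sum raddf_sum. Qed.

Lemma cdotDr n (u v w : 'cV[C]_n) : cdot u (v + w) = cdot u v + cdot u w.
Proof. by rewrite /cdot mulmxDr mxE. Qed.

Lemma cdotZr n a (u v : 'cV[C]_n) : cdot u (a *: v) = a * cdot u v.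
Proof. by rewrite /cdot -scalemxAr mxE. Qed.

Lemma cdot0r n (u : 'cV[C]_n) : cdot u 0 = 0.
Proof. by rewrite /cdot mulmx0 mxE. Qed.

Lemma cdot_sumr n (I : Type) (s : seq I) (f : I -> 'cV[C]_n) u :
  cdot u (\sum_(i <- s) f i) = \sum_(i <- s) cdot u (f i).
Proof. by rewrite /cdot mulmx_sumr summxE. Qed.

Lemma cdotC n (u v : 'cV[C]_n) : cdot v u = (cdot u v)^*.
Proof. by rewrite /cdot -[u in LHS]trmxCK -adjM !mxE. Qed.

Lemma cdotZl n a (u v : 'cV[C]_n) : cdot (a *: u) v = a^* * cdot u v.
Proof. by rewrite cdotC cdotZr rmorphM /= -cdotC. Qed.

Lemma cdot_eq0C n (u v : 'cV[C]_n) : cdot u v = 0 -> cdot v u = 0.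
Proof. by move=> uv0; rewrite cdotC uv0 conjC0. Qed.

Lemma cdot_adj m n (A : 'M[C]_(m, n)) u v :
  cdot (A *m u) v = cdot u (A^t* *m v).
Proof. by rewrite /cdot adjM mulmxA. Qed.

Lemma cdot_dotmx n (u v : 'cV[C]_n) : cdot u v = dotmx (u^t*) (v^t*).
Proof. by rewrite dotmxE trmxCK. Qed.

Lemma adj_eq0 m n (A : 'M[C]_(m, n)) : (A^t* == 0) = (A == 0).
Proof. by rewrite map_mx_eq0 trmx_eq0. Qed.

Lemma cdot_gt0 n (u : 'cV[C]_n) : (0 < cdot u u) = (u != 0).
Proof. by rewrite cdot_dotmx dnorm_gt0 adj_eq0. Qed.

Lemma cdot_eq0 n (u : 'cV[C]_n) : cdot u u = 0 -> u = 0.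
Proof. by move=> uu0; apply/eqP; rewrite -[_ == _]negbK -cdot_gt0 uu0 ltxx. Qed.

Lemma outer_mul m n (w : 'cV[C]_m) (v u : 'cV[C]_n) :
  (w *m v^t*) *m u = cdot v u *: w.
Proof. by rewrite -mulmxA [v^t* *m u]mx11_scalar mul_mx_scalar. Qed.

Lemma cdot_delta m n (A : 'M[C]_(m, n)) i j :
  A i j = cdot (delta_mx i 0) (A *m delta_mx j 0).
Proof.
rewrite /cdot -colE mxE (bigD1 i) //= big1 ?addr0 => [|k /negPf ki].
  by rewrite !mxE !eqxx conjC1 mul1r.
by rewrite !mxE ki conjC0 mul0r.
Qed.

Lemma mx_cdotP m n (A B : 'M[C]_(m, n)) :
  (forall u v, cdot u (A *m v) = cdot u (B *m v)) -> A = B.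
Proof. by move=> AB; apply/matrixP=> i j; rewrite !cdot_delta AB. Qed.

Lemma mx_mulP m n (A B : 'M[C]_(m, n)) :
  (forall v : 'cV_n, A *m v = B *m v) -> A = B.
Proof. by move=> AB; apply: mx_cdotP => u v; rewrite AB. Qed.

Lemma adj_mul_eq0 m n (A : 'M[C]_(m, n)) : A^t* *m A = 0 -> A = 0.
Proof.
move=> AA0; apply: mx_mulP => v; rewrite mul0mx; apply: cdot_eq0.
by rewrite cdot_adj mulmxA AA0 mul0mx cdot0r.
Qed.

(** [A - a] is normal along with [A], so [A - a] and its adjoint stretch every
    vector equally and have the same kernel.  This is used on a whole matrix of
    eigenvectors at once because the eigenprojections are such matrices. *)
Lemma normal_adj_eigen m n (A : 'M[C]_n) (a : C) (V : 'M_(n, m)) :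
  A \is normalmx -> A *m V = a *: V -> A^t* *m V = a^* *: V.
Proof.
move=> /normalmxP AAC AV; apply/eqP; rewrite -subr_eq0; apply/eqP.
have e0 : (A^t* - a^*%:M) *m V = 0 -> A^t* *m V - a^* *: V = 0.
  by rewrite mulmxBl mul_scalar_mx.
apply: e0; apply: adj_mul_eq0; rewrite adjM.
have adjB : (A^t* - a^*%:M)^t* = A - a%:M.
  by rewrite linearB map_mxB /= trmxCK tr_scalar_mx map_scalar_mx /= conjCK.
rewrite adjB mulmxA -[_ *m _ *m (_ - _)]mulmxA.
have -> : (A - a%:M) *m (A^t* - a^*%:M) = (A^t* - a^*%:M) *m (A - a%:M).
  rewrite !mulmxBl !mulmxBr AAC !mul_mx_scalar !mul_scalar_mx !opprB.
  by rewrite !scale_scalar_mx mulrC [LHS]addrACA [RHS]addrACA [- _ - _]addrC.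
by rewrite -!mulmxA [(A - _) *m _]mulmxBl AV mul_scalar_mx subrr !mulmx0.
Qed.

(** Both products equal [a *: v v^*]: on the right because [v] is an eigenvector
    of [A^*] for the conjugate eigenvalue. *)
Lemma normal_outer_comm n (A : 'M[C]_n) a (v : 'cV_n) :
  A \is normalmx -> A *m v = a *: v -> A *m (v *m v^t*) = v *m v^t* *m A.
Proof.
move=> Anormal Av; rewrite mulmxA Av.
rewrite -[v in _ *m v^t*]scale1r -mulmxA -[A in RHS]trmxCK -adjM.
by rewrite (normal_adj_eigen Anormal Av) adjZ conjCK scale1r -scalemxAl -scalemxAr.
Qed.

(** * Subspaces given by matrices *)

Lemma mulfunE m n (A : 'M[C]_(m, n)) (v : 'cV_n) : mulfun A v = A *m v.
Proof. exact: lfunE. Qed.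

Lemma mximageP m n (A : 'M[C]_(m, n)) v :
  reflect (exists u : 'cV_n, v = A *m u) (v \in mximage A).
Proof.
apply: (iffP memv_imgP) => [[u _ ->]|[u ->]]; exists u; rewrite ?memvf //.
  exact: mulfunE.
by rewrite mulfunE.
Qed.

Lemma mximage_idemP n (A : 'M[C]_n) v : A *m A = A ->
  reflect (A *m v = v) (v \in mximage A).
Proof.
move=> AA; apply: (iffP (mximageP A v)) => [[u ->]|Av]; first by rewrite mulmxA AA.
by exists v.
Qed.

Lemma leigenspaceP n (A : 'M[C]_n) a v :
  reflect (A *m v = a *: v) (v \in passmx.leigenspace (mulfun A) a).
Proof.
rewrite memv_ker add_lfunE opp_lfunE scale_lfunE id_lfunE mulfunE subr_eq0.
exact: eqP.
Qed.

Lemma leigenvalueP n (A : 'M[C]_n) a :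
  reflect (exists v, is_eigenvector A a v) (passmx.leigenvalue (mulfun A) a).
Proof.
apply: (iffP idP) => [|[v [v0 Av]]].
  rewrite /passmx.leigenvalue -vpick0 => v0.
  by exists (vpick (passmx.leigenspace (mulfun A) a)); split=> //;
    apply/leigenspaceP/memv_pick.
apply/eqP=> a0; move/leigenspaceP: Av; rewrite a0 memv0.
exact/negP.
Qed.

Lemma cdot_span n (s : seq 'cV[C]_n) u :
  {in s, forall x, cdot u x = 0} -> {in <<s>>%VS, forall x, cdot u x = 0}.
Proof.
move=> us x; have /subvP sub : (<<s>> <= lker (mulfun (u^t*)))%VS.
  apply/span_subvP => y ys; rewrite memv_ker mulfunE; apply/eqP.
  by rewrite [LHS]mx11_scalar [X in X%:M](us y ys) raddf0.
by move=> /sub; rewrite memv_ker mulfunE /cdot => /eqP ->; rewrite mxE.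
Qed.

(** * Orthonormal families *)

(** Indexing by elements and not by positions makes concatenation and membership
    easy; [orthonormal_basisP] relates the two. *)
Definition orthonormal n (s : seq 'cV[C]_n) :=
  uniq s /\ {in s &, forall x y, cdot x y = (x == y)%:R}.

Lemma orthonormal_cat n (s t : seq 'cV[C]_n) :
  orthonormal s -> orthonormal t ->
  {in s & t, forall x y, cdot x y = 0} -> orthonormal (s ++ t).
Proof.
move=> [us os] [ut ot] st.
have disj x : x \in s -> x \in t -> False.
  move=> xs xt; move: (st x x xs xt); rewrite os // eqxx.
  by move/eqP; rewrite oner_eq0.
split=> [|x y].
  rewrite cat_uniq us ut andbT; apply/hasPn => x xt; apply/negP => xs.
  exact: disj xs xt.
rewrite !mem_cat => /orP[xs|xt] /orP[ys|yt]; [exact: os| | |exact: ot].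
  by rewrite st //; case: eqP => // xy; case: (disj x); rewrite // xy.
by rewrite cdot_eq0C ?st //; case: eqP => // xy; case: (disj y); rewrite // -xy.
Qed.

Lemma orthonormal_nil n : orthonormal ([::] : seq 'cV[C]_n).
Proof. by split. Qed.

Lemma orthonormal_seq1 n (x : 'cV[C]_n) : cdot x x = 1 -> orthonormal [:: x].
Proof. by move=> xx; split=> // y z; rewrite !inE => /eqP-> /eqP->; rewrite eqxx. Qed.

Lemma orthonormal_flatten n (I : eqType) (r : seq I) (s : I -> seq 'cV[C]_n) :
  uniq r -> (forall i, orthonormal (s i)) ->
  (forall i j, i != j -> {in s i & s j, forall x y, cdot x y = 0}) ->
  orthonormal (flatten [seq s i | i <- r]).
Proof.
move=> + os oss; elim: r => [_|i r IHr /= /andP[ir /IHr osr]].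
  exact: orthonormal_nil.
apply: orthonormal_cat => // x y xi /flatten_mapP[j jr yj].
by apply: oss xi yj; apply: contraNneq ir => ->.
Qed.

Lemma orthonormal_neq0 n (s : seq 'cV[C]_n) x : orthonormal s -> x \in s -> x != 0.
Proof. by move=> [_ os] xs; rewrite -cdot_gt0 os // eqxx ltr01. Qed.

(** A member lying in the span of the others would be orthogonal to itself. *)
Lemma orthonormal_free n (s : seq 'cV[C]_n) : orthonormal s -> free s.
Proof.
elim: s => [|x s IHs] [/=]; first by rewrite nil_free.
case/andP=> xs us os; rewrite free_cons IHs ?andbT; last first.
  by split=> // y z ys zs; apply: os; rewrite inE ?ys ?zs orbT.
have xx1 : cdot x x = 1 by rewrite os ?mem_head // eqxx.
apply/negP => /(@cdot_span _ s x) xx0.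
have: cdot x x = 0.
  apply: xx0 => y ys; rewrite os ?mem_head // ?inE ?ys ?orbT //.
  by case: eqP ys xs => // <- ->.
by rewrite xx1 => /eqP; rewrite oner_eq0.
Qed.

Lemma orthonormal_basisP n (U : {vspace 'cV[C]_n}) s :
  orthonormal_basis U s <-> orthonormal s /\ <<s>>%VS = U.
Proof.
split=> [[/andP[/eqP sU _] os]|[os sU]].
  have us : uniq s.
    apply/(uniqP 0) => i j; rewrite !inE => si sj ij; apply/eqP.
    move: (os i j si sj); rewrite -ij os // eqxx.
    by case: eqP => // _ /eqP; rewrite oner_eq0.
  split=> //; split=> // _ _ /(nthP 0)[i si <-] /(nthP 0)[j sj <-].
  by rewrite os // nth_uniq.
split; first by rewrite /basis_of sU eqxx orthonormal_free.
by case: os => us os i j si sj; rewrite os ?mem_nth // nth_uniq.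
Qed.

(** The vectors fixed by the sum of the [x x^*] form a subspace, and it contains
    every [x] in [s]. *)
Lemma sum_outer_span n (s : seq 'cV[C]_n) u :
  orthonormal s -> u \in <<s>>%VS -> (\sum_(x <- s) x *m x^t*) *m u = u.
Proof.
move=> [us os]; set P := \sum_(x <- s) _.
have /subvP sub : (<<s>> <= passmx.leigenspace (mulfun P) 1)%VS.
  apply/span_subvP => x xs; apply/leigenspaceP; rewrite scale1r mulmx_suml.
  rewrite (bigD1_seq x) //= outer_mul os // eqxx scale1r big_seq_cond.
  rewrite big1 ?addr0 // => y /andP[ys /negPf yx].
  by rewrite outer_mul os // yx scale0r.
by move=> /sub /leigenspaceP; rewrite scale1r.
Qed.

(** The sum on the right fixes [Im E], and it sends [u] and [E u] to the same
    vector, since [<x, E u> = <E x, u> = <x, u>] for each basis vector [x]. *)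
Lemma proj_sum_outer n (E : 'M[C]_n) s :
  E *m E = E -> E^t* = E -> orthonormal_basis (mximage E) s ->
  E = \sum_(x <- s) x *m x^t*.
Proof.
move=> EE Eadj /orthonormal_basisP[os sE]; apply: mx_mulP => u.
rewrite -[LHS](sum_outer_span os) ?sE; last by apply/mximageP; exists u.
rewrite !mulmx_suml [LHS]big_seq [RHS]big_seq; apply: eq_bigr => x xs.
rewrite !outer_mul -[E in cdot x (E *m u)]Eadj -cdot_adj.
by have /mximage_idemP -> : x \in mximage E by rewrite -sE memv_span.
Qed.

(** Gram-Schmidt in one statement: with [s] empty it gives the existence of an
    orthonormal basis, in general the completion of one of a subspace. *)
Lemma orthonormal_extend n (U : {vspace 'cV[C]_n}) s :
  orthonormal s -> {subset s <= U} ->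
  exists t, orthonormal (s ++ t) /\ <<s ++ t>>%VS = U.
Proof.
have [k] := ubnP (\dim U - size s); elim: k s => // k IHk s.
rewrite ltnS => dk os sU; have /span_subvP sUV := sU.
have [/subvPn[u uU us]|Us] := boolP (~~ (U <= <<s>>)%VS); last first.
  exists [::]; rewrite cats0; split=> //; apply/eqP.
  by rewrite eqEsubv sUV -[X in _ && X]negbK.
pose P := \sum_(x <- s) x *m x^t*; pose w := u - P *m u.
have Pu : P *m u \in <<s>>%VS.
  rewrite mulmx_suml big_seq; apply: memv_suml => x xs.
  by rewrite outer_mul memvZ // memv_span.
have w0 : w != 0 by rewrite subr_eq0; apply: contraNneq us => ->.
have sw : {in s, forall x, cdot x w = 0}.
  move=> x xs; rewrite cdotDr -scaleN1r cdotZr mulN1r.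
  suff -> : cdot x (P *m u) = cdot x u by rewrite subrr.
  have Padj : P^t* = P.
    rewrite /P adj_sum; apply: eq_bigr => y _.
    by rewrite adjM trmxCK.
  by rewrite -[P]Padj -cdot_adj sum_outer_span // memv_span.
(* [w] is the part of [u] orthogonal to [s]; normalised, it extends [s]. *)
pose e := (sqrtC (cdot w w))^-1 *: w.
have ww0 : 0 < cdot w w by rewrite cdot_gt0.
have ee : cdot e e = 1.
  rewrite cdotZl cdotZr mulrA fmorphV /= geC0_conj ?sqrtC_ge0 ?ltW //.
  by rewrite -invfM -expr2 sqrtCK mulVf ?gt_eqF.
have [|||t] := IHk (rcons s e).
- rewrite size_rcons subnS; apply: leq_trans dk.
  rewrite prednK ?leqnn // subn_gt0.
  have /eqP <- : free s by exact: orthonormal_free.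
  rewrite ltn_neqAle (dimv_leqif_sup sUV).1 (dimv_leqif_sup sUV).2 andbT.
  by apply: contra us => /subvP; apply.
- rewrite -cats1; apply: orthonormal_cat => //; first exact: orthonormal_seq1.
  by move=> x y xs; rewrite inE => /eqP->; rewrite cdotZr (sw x xs) mulr0.
- move=> x; rewrite mem_rcons inE => /orP[/eqP->|/sU//].
  by rewrite memvZ // memvB // (subvP sUV).
by rewrite cat_rcons => ?; exists (e :: t).
Qed.

End ScalarProduct.

(** * Spectral decompositions *)

Section Spectral.
Variables (C : numClosedFieldType) (n d : nat) (A : 'M[C]_n).
Variables (theta : 'I_d -> C) (E : 'I_d -> 'M[C]_n).
Hypotheses (normalA : A \is normalmx) (specA : spectral_decomposition A theta E).

Lemma spectral_mulr i : A *m E i = theta i *: E i.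
Proof.
apply: mx_mulP => v; rewrite -mulmxA -scalemxAl; apply/leigenspaceP.
by rewrite -(spectral_image specA); apply/mximageP; exists v.
Qed.

(** [A E i = theta i *: E i] holds because the columns of [E i] are eigenvectors;
    for rows this needs normality of [A]. *)
Lemma spectral_mull i : E i *m A = theta i *: E i.
Proof.
rewrite -[A]trmxCK -[E i in LHS](spectral_selfadj specA) -adjM.
rewrite (normal_adj_eigen normalA (spectral_mulr i)) adjZ conjCK.
by rewrite (spectral_selfadj specA).
Qed.

Lemma spectral_orth i j : i != j -> E i *m E j = 0.
Proof.
move=> ij; apply/eqP; have: (theta i - theta j) *: (E i *m E j) == 0.
  rewrite scalerBl scalemxAl -spectral_mull -mulmxA spectral_mulr.
  by rewrite -scalemxAr subrr.
rewrite scaler_eq0 subr_eq0 => /orP[/eqP/(spectral_inj specA) eij|//].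
by rewrite eij eqxx in ij.
Qed.

Lemma spectral_in_eigen i (v : 'cV_n) : E i *m v = v -> A *m v = theta i *: v.
Proof. by move=> <-; rewrite mulmxA spectral_mulr scalemxAl. Qed.

Lemma spectral_eigen a v :
  is_eigenvector A a v -> exists i, theta i = a /\ E i *m v = v.
Proof.
move=> av; have /leigenvalueP/(spectral_eigenvalue specA)[i ia] :
  exists v, is_eigenvector A a v by exists v.
exists i; split=> //; apply/(mximage_idemP _ (spectral_idem specA i)).
rewrite (spectral_image specA); apply/leigenspaceP; rewrite ia.
exact: av.2.
Qed.

(** Put [P = 1 - \sum_i E i].  Then [A P = 0], so a nonzero [P v] would be an
    eigenvector for 0 and hence fixed by some [E i], yet [E i P = 0]. *)
Lemma spectral_sum_proj : \sum_i E i = 1%:M.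
Proof.
apply/esym; apply: mx_mulP => v; apply/eqP; rewrite -subr_eq0 -mulmxBl.
set P := 1%:M - _; apply/negP=> /negP Pv0.
have APv : A *m (P *m v) = 0 *: (P *m v).
  rewrite mulmxA mulmxBr mulmx1 mulmx_sumr.
  rewrite [X in X - _](spectral_sum specA) (eq_bigr _ (fun i _ => spectral_mulr i)).
  by rewrite subrr mul0mx scale0r.
have [|i [_ iPv]] := @spectral_eigen 0 (P *m v); first by split.
move: Pv0; rewrite -iPv mulmxA mulmxBr mulmx1 mulmx_sumr (bigD1 i) //=.
rewrite big1 => [|j ji]; last by rewrite spectral_orth // eq_sym.
by rewrite (spectral_idem specA) addr0 subrr mul0mx eqxx.
Qed.

Lemma spectral_exp k : A ^+ k = \sum_i theta i ^+ k *: E i.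
Proof.
elim: k => [|k IHk].
  under eq_bigr do rewrite expr0 scale1r.
  by rewrite spectral_sum_proj.
rewrite exprSr IHk -mulmxE mulmx_suml; apply: eq_bigr => i _.
by rewrite -scalemxAl spectral_mull scalerA exprSr.
Qed.

(** Lagrange interpolation: a polynomial that is 1 at [theta i] and 0 at the
    other eigenvalues takes [A] to [E i]. *)
Lemma spectral_proj_poly i :
  exists q : {poly C}, E i = \sum_(k < size q) q`_k *: A ^+ k.
Proof.
pose q0 : {poly C} := \prod_(j | j != i) ('X - (theta j)%:P).
have q0j j : j != i -> q0.[theta j] = 0.
  by move=> ji; rewrite horner_prod (bigD1 j) //= !hornerE subrr mul0r.
have q0i : q0.[theta i] != 0.
  rewrite horner_prod; apply/prodf_neq0 => j ji.
  rewrite !hornerE subr_eq0; apply: contra ji => /eqP/(spectral_inj specA) ->.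
  exact: eqxx.
exists (q0.[theta i]^-1 *: q0); set q := _ *: q0.
under eq_bigr do rewrite spectral_exp scaler_sumr.
rewrite exchange_big /=.
have qE j : \sum_(k < size q) q`_k *: (theta j ^+ k *: E j) = q.[theta j] *: E j.
  by rewrite horner_coef scaler_suml; apply: eq_bigr => k _; rewrite scalerA.
rewrite (eq_bigr _ (fun j _ => qE j)) (bigD1 i) //= hornerZ mulVf // scale1r.
by rewrite big1 ?addr0 // => j ji; rewrite hornerZ (q0j j ji) mulr0 scale0r.
Qed.

(** When the blocks between different eigenspaces vanish, [E i B] and [B E i] are
    both equal to the diagonal block [E i B E i]. *)
Lemma spectral_off_diag_comm (B : 'M_n) :
  (forall j k, j != k -> E j *m B *m E k = 0) ->
  forall i, E i *m B = B *m E i.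
Proof.
move=> EBE i; have -> : E i *m B = E i *m B *m E i.
  rewrite -[LHS]mulmx1 -spectral_sum_proj mulmx_sumr (bigD1 i) //=.
  by rewrite big1 ?addr0 // => j ji; rewrite EBE // eq_sym.
rewrite -[RHS]mul1mx -spectral_sum_proj mulmx_suml (bigD1 i) //= -mulmxA.
by rewrite [X in _ + X]big1 ?addr0 // => j ji; rewrite mulmxA EBE.
Qed.

(** Computing [E j A B E k] in two ways gives
    [(theta j - theta k) *: (E j B E k) = 0], so a matrix commuting with [A] has
    only diagonal blocks. *)
Lemma spectral_commP (B : 'M_n) :
  A *m B = B *m A <-> forall i, E i *m B = B *m E i.
Proof.
split=> [AB|EB]; last first.
  rewrite (spectral_sum specA).
  rewrite mulmx_suml mulmx_sumr; apply: eq_bigr => i _.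
  by rewrite -scalemxAl -scalemxAr EB.
apply: spectral_off_diag_comm => j k jk; apply/eqP.
have: (theta j - theta k) *: (E j *m B *m E k) == 0.
  rewrite scalerBl 2![in X in X - _]scalemxAl -spectral_mull -(mulmxA _ A) AB.
  by rewrite mulmxA -(mulmxA _ A) spectral_mulr -scalemxAr subrr.
rewrite scaler_eq0 subr_eq0 => /orP[/eqP/(spectral_inj specA) ejk|//].
by rewrite ejk eqxx in jk.
Qed.

Lemma spectral_mull_exp i k : E i *m A ^+ k = theta i ^+ k *: E i.
Proof.
elim: k => [|k IHk]; first by rewrite !expr0 mulmx1 scale1r.
by rewrite exprSr -mulmxE mulmxA IHk -scalemxAl spectral_mull scalerA exprSr.
Qed.

(** Expand the second power on the [E i] and move each [E i] to the other side,
    where it absorbs the first power as a scalar. *)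
Lemma cdot_exp_orth (x y : 'cV_n) k l :
  (forall i, cdot (E i *m x) y = 0) -> cdot (A ^+ k *m x) (A ^+ l *m y) = 0.
Proof.
move=> Exy; rewrite (spectral_exp l) mulmx_suml cdot_sumr big1 // => i _.
rewrite -scalemxAl cdotZr -[E i](spectral_selfadj specA) -cdot_adj mulmxA.
by rewrite spectral_mull_exp -scalemxAl cdotZl Exy !mulr0.
Qed.

Lemma krylov_proj i v : in_krylov A v (E i *m v).
Proof.
have [q ->] := spectral_proj_poly i; exists (size q).
rewrite mulmx_suml; apply: memv_suml => k _; rewrite -scalemxAl memvZ //.
by apply/memv_span/mapP; exists (val k); rewrite ?mem_iota /=.
Qed.

End Spectral.

(** * Restriction to K and extension by zero *)

Section Restriction.
Variables (C : numClosedFieldType) (n : nat) (K : {set 'I_n}).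

(** The matrix of the inclusion of C^K in C^X; its adjoint is the restriction
    map ([restrictE]). *)
Definition extend_mx : 'M[C]_(n, #|K|) :=
  \matrix_(x, k) (enum_val k == x)%:R.

Lemma extendE v : extend K v = extend_mx *m v.
Proof.
apply/colP => x; rewrite !mxE; case: pickP => [k /= /eqP kx|K'x] /=.
  rewrite (bigD1 k) //= mxE kx eqxx mul1r big1 ?addr0 // => l lk.
  by rewrite mxE -kx (inj_eq enum_val_inj) (negPf lk) mul0r.
by rewrite big1 // => k _; rewrite mxE K'x mul0r.
Qed.

Lemma restrictE (v : 'cV[C]_n) : restrict K v = extend_mx^t* *m v.
Proof.
apply/colP => k; rewrite !mxE (bigD1 (enum_val k)) //= !mxE eqxx conjC1 mul1r.
by rewrite big1 ?addr0 // => x /negPf kx; rewrite !mxE eq_sym kx conjC0 mul0r.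
Qed.

Lemma restrict_mxE (A : 'M[C]_n) :
  restrict_mx K A = extend_mx^t* *m A *m extend_mx.
Proof.
apply/matrixP => k l; rewrite !mxE (bigD1 (enum_val l)) //= !mxE eqxx mulr1.
rewrite [X in _ = _ + X]big1 ?addr0 => [|x /negPf lx]; last first.
  by rewrite !mxE eq_sym lx mulr0.
rewrite (bigD1 (enum_val k)) //= !mxE eqxx conjC1 mul1r big1 ?addr0 //.
by move=> x /negPf kx; rewrite !mxE eq_sym kx conjC0 mul0r.
Qed.

Lemma restrict_mx_sum (I : Type) (s : seq I) (A : I -> 'M[C]_n) :
  restrict_mx K (\sum_(i <- s) A i) = \sum_(i <- s) restrict_mx K (A i).
Proof.
rewrite restrict_mxE mulmx_sumr mulmx_suml.
by apply: eq_bigr => i _; rewrite restrict_mxE.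
Qed.

Lemma restrict_mxZ a (A : 'M[C]_n) :
  restrict_mx K (a *: A) = a *: restrict_mx K A.
Proof. by rewrite !restrict_mxE -scalemxAr -scalemxAl. Qed.

Lemma restrict_mx_outer (x : 'cV[C]_n) :
  restrict_mx K (x *m x^t*) = restrict K x *m (restrict K x)^t*.
Proof. by rewrite restrict_mxE restrictE adjM trmxCK !mulmxA. Qed.

Lemma restrict_mul_extend (A : 'M[C]_n) v :
  restrict K (A *m extend K v) = restrict_mx K A *m v.
Proof. by rewrite restrictE extendE restrict_mxE !mulmxA. Qed.

Lemma cdot_extend (v : 'cV[C]_#|K|) x :
  cdot (extend K v) x = cdot v (restrict K x).
Proof. by rewrite extendE restrictE cdot_adj. Qed.

End Restriction.

(** * Commutation, adapted bases and Krylov spaces *)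

Section Equivalences.
Variables (C : numClosedFieldType) (n : nat) (K : {set 'I_n}).
Variables (M : 'M[C]_n) (H : 'M[C]_#|K|).
Variables (d : nat) (theta : 'I_d -> C) (E : 'I_d -> 'M[C]_n).
Variables (r : nat) (rho : 'I_r -> C) (F : 'I_r -> 'M[C]_#|K|).
Hypotheses (normalM : M \is normalmx) (normalH : H \is normalmx).
Hypotheses (specM : spectral_decomposition M theta E).
Hypotheses (specH : spectral_decomposition H rho F).

Local Notation Er i := (restrict_mx K (E i)).

Lemma cdot_restrict_proj i v w :
  cdot (E i *m extend K v) (extend K w) = cdot (Er i *m v) w.
Proof.
by rewrite -restrict_mul_extend [RHS]cdotC -cdot_extend -cdotC.
Qed.

Lemma cdot_proj_proj i x y : cdot (E i *m x) (E i *m y) = cdot (E i *m x) y.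
Proof.
rewrite -[X in cdot _ (X *m y)](spectral_selfadj specM) -cdot_adj mulmxA.
by rewrite (spectral_idem specM).
Qed.

Lemma restrict_outer_comm (x : 'cV_n) :
  restrict K x = 0 \/ (exists b, is_eigenvector H b (restrict K x)) ->
  H *m restrict_mx K (x *m x^t*) = restrict_mx K (x *m x^t*) *m H.
Proof.
rewrite restrict_mx_outer => -[->|[b [_ Hx]]]; first by rewrite !mul0mx mulmx0.
exact: normal_outer_comm Hx.
Qed.

(** Multiply [M ^+ k] by the resolution of the identity given by the cospectral
    basis; each term is then a scalar times [psi psi^*]. *)
Lemma cospectral_comm_exp k : cospectral K H M ->
  H *m restrict_mx K (M ^+ k) = restrict_mx K (M ^+ k) *m H.
Proof.
case=> s /orthonormal_basisP[os sU] sP.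
have -> : M ^+ k = \sum_(x <- s) M ^+ k *m (x *m x^t*).
  apply: mx_mulP => v; rewrite -mulmx_sumr -mulmxA sum_outer_span //.
  by rewrite sU memvf.
rewrite restrict_mx_sum mulmx_suml mulmx_sumr big_seq [RHS]big_seq.
apply: eq_bigr => x /sP[[a [_ Mx]] rx].
have -> : M ^+ k *m (x *m x^t*) = a ^+ k *: (x *m x^t*).
  rewrite mulmxA scalemxAl; congr (_ *m _); elim: k => [|k IHk].
    by rewrite !expr0 mul1mx scale1r.
  by rewrite exprS -mulmxE -mulmxA IHk -scalemxAr Mx scalerA exprSr.
by rewrite restrict_mxZ -scalemxAr -scalemxAl restrict_outer_comm.
Qed.

Lemma comm_exp_comm_proj i :
  (forall k, H *m restrict_mx K (M ^+ k) = restrict_mx K (M ^+ k) *m H) ->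
  H *m Er i = Er i *m H.
Proof.
move=> HM; have [q ->] := spectral_proj_poly normalM specM i.
rewrite restrict_mx_sum mulmx_suml mulmx_sumr; apply: eq_bigr => k _.
by rewrite restrict_mxZ -scalemxAl -scalemxAr HM.
Qed.

Lemma comm_proj_orth i j k v w : F j *m Er i = Er i *m F j ->
  j != k -> F j *m v = v -> F k *m w = w -> cdot (Er i *m v) w = 0.
Proof.
move=> FE jk <- <-; rewrite mulmxA -FE -mulmxA cdot_adj.
by rewrite (spectral_selfadj specH) mulmxA (spectral_orth _ specH) // mul0mx cdot0r.
Qed.

Lemma comm_proj_eigen_orth i a b v w : (forall j, F j *m Er i = Er i *m F j) ->
  is_eigenvector H a v -> is_eigenvector H b w -> a != b ->
  cdot (Er i *m v) w = 0.
Proof.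
move=> FE /(spectral_eigen specH)[j [<- Fv]] /(spectral_eigen specH)[k [<- Fw]].
by move=> jk; apply: comm_proj_orth Fv Fw => //; apply: contraNneq jk => ->.
Qed.

(** Each [F j u] is zero or an eigenvector of [H], so the hypothesis says exactly
    that the off-diagonal blocks of [restrict_mx K (E i)] vanish. *)
Lemma eigen_orth_comm_proj i :
  (forall a b v w, is_eigenvector H a v -> is_eigenvector H b w -> a != b ->
    cdot (Er i *m v) w = 0) ->
  forall j, F j *m Er i = Er i *m F j.
Proof.
move=> orth; apply: (spectral_off_diag_comm normalH specH) => j k jk.
apply: mx_cdotP => u v; rewrite mul0mx cdot0r -!mulmxA.
rewrite -[F j](spectral_selfadj specH) -cdot_adj.
have [->|Fu0] := eqVneq (F j *m u) 0; first by rewrite cdotC cdot0r conjC0.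
have [->|Fv0] := eqVneq (F k *m v) 0; first by rewrite mulmx0 cdot0r.
have eigF l x : F l *m x != 0 -> is_eigenvector H (rho l) (F l *m x).
  by split=> //; apply: (spectral_in_eigen specH); rewrite mulmxA (spectral_idem specH).
apply: cdot_eq0C; apply: orth (eigF _ _ Fv0) (eigF _ _ Fu0) _.
by apply: contra jk => /eqP/(spectral_inj specH) ->.
Qed.

(** The space whose dimension is the multiplicity prescribed for [j] in an
    adapted basis of [Im (E i)]. *)
Definition proj_extend i j : {vspace 'cV[C]_n} :=
  (linfun (fun v => E i *m extend K v) @: mximage (F j))%VS.

Lemma proj_extendP i j x :
  reflect (exists2 v, F j *m v = v & x = E i *m extend K v)
          (x \in proj_extend i j).
Proof.
have fE v : linfun (fun v => E i *m extend K v) v = E i *m extend K v.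
  (* The anonymous function is a composition of linear maps, and it is as such
     that its linearity is inferred. *)
  exact: (lfunE (mulmx (E i) \o extend K)).
apply: (iffP memv_imgP) => -[v Fv ->]; exists v; rewrite ?fE //.
  by apply/mximage_idemP => //; apply: (spectral_idem specH).
by apply/mximage_idemP => //; apply: (spectral_idem specH).
Qed.

(** For [x = E i v] with [v] extended from K, [|x|^2] is the scalar product of
    [v] with the restriction of [x]. *)
Lemma proj_extend_restrict_neq0 i j x :
  x \in proj_extend i j -> x != 0 -> restrict K x != 0.
Proof.
case/proj_extendP=> v _ ->; apply: contraNneq => rx0; apply/eqP/cdot_eq0.
by rewrite cdot_proj_proj cdotC cdot_extend rx0 cdot0r conjC0.
Qed.

(** The restriction of [y] is orthogonal to each [F j v], as
    [<F j v, restrict K y> = <E i (extend K (F j v)), y>]; and the [F j v] add up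
    to [v]. *)
Lemma proj_complement_restrict0 i y : E i *m y = y ->
  (forall j, {in proj_extend i j, forall x, cdot x y = 0}) -> restrict K y = 0.
Proof.
move=> Ey orth; apply: cdot_eq0; set v := restrict K y.
rewrite -[v in cdot v _]mul1mx -(spectral_sum_proj normalH specH) mulmx_suml.
apply: cdot_eq0C; rewrite cdot_sumr big1 // => j _; apply: cdot_eq0C.
rewrite -cdot_extend -Ey -[E i](spectral_selfadj specM) -cdot_adj.
apply: (orth j); apply/proj_extendP; exists (F j *m v) => //.
by rewrite mulmxA (spectral_idem specH).
Qed.

(** Concatenate orthonormal bases of the [proj_extend i j], which are pairwise
    orthogonal, and complete the result to a basis of [Im (E i)].  The vectors
    added in the completion restrict to zero, and a vector coming from [j] is
    counted for [j] alone since the [Im (F j)] meet pairwise in 0. *)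
Lemma adapted_basis i : (forall j, F j *m Er i = Er i *m F j) ->
  exists s : seq 'cV[C]_n,
    [/\ orthonormal_basis (mximage (E i)) s,
        forall j,
          count (fun psi => (restrict K psi != 0) &&
                            (restrict K psi \in mximage (F j))) s
          = \dim (proj_extend i j)
      & forall psi, psi \in s ->
          (exists j, restrict K psi != 0 /\
                     restrict K psi \in mximage (F j)) \/
          restrict K psi = 0].
Proof.
move=> FE.
have /fin_all_exists[s sP] j : exists s, orthonormal s /\ <<s>>%VS = proj_extend i j.
  exact: (orthonormal_extend (orthonormal_nil _ _)).
have sU j x : x \in s j -> x \in proj_extend i j.
  by move=> xs; rewrite -(sP j).2 memv_span.
pose S := flatten [seq s j | j <- enum 'I_r].
have oS : orthonormal S.
  apply: orthonormal_flatten => [|j|j k jk x y /sU xj /sU yk].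
  - exact: enum_uniq.
  - exact: (sP j).1.
  case/proj_extendP: xj => v Fv ->; case/proj_extendP: yk => w Fw ->.
  by rewrite cdot_proj_proj cdot_restrict_proj; apply: comm_proj_orth Fv Fw.
have SE : {subset S <= mximage (E i)}.
  move=> x /flatten_mapP[j _ /sU/proj_extendP[v _ ->]].
  by apply/mximageP; exists (extend K v).
have [t [oSt St]] := orthonormal_extend oS SE.
have t0 y : y \in t -> restrict K y = 0.
  move=> yt; apply: (proj_complement_restrict0 (i := i)) => [|j x].
    apply/mximage_idemP; first exact: (spectral_idem specM).
    by rewrite -St memv_span // mem_cat yt orbT.
  rewrite -(sP j).2 => xs; apply: cdot_eq0C; move: x xs; apply: cdot_span.
  move=> x xs; have xS : x \in S.
    by apply/flatten_mapP; exists j; rewrite ?mem_enum.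
  case: oSt => uSt ->; rewrite ?mem_cat ?yt ?xS ?orbT //.
  case: eqP => // yx; move: uSt; rewrite cat_uniq => /and3P[_ /hasPn/(_ y yt)].
  by rewrite /= yx xS.
have sr j x : x \in s j ->
    restrict K x != 0 /\ restrict K x \in mximage (F j).
  move=> xs; split.
    apply: proj_extend_restrict_neq0 (sU _ _ xs) _.
    exact: orthonormal_neq0 (sP j).1 xs.
  case/sU/proj_extendP: xs => v Fv ->; rewrite restrict_mul_extend.
  by apply/mximageP; exists (Er i *m v); rewrite mulmxA FE -mulmxA Fv.
exists (S ++ t); split=> [|j|x].
- exact/orthonormal_basisP.
- rewrite count_cat [X in (_ + X)%N](eq_in_count (a2 := pred0)); last first.
    by move=> y /t0 -> /=; rewrite eqxx.
  rewrite count_pred0 addn0 count_flatten -map_comp sumnE big_map big_enum /=.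
  rewrite (bigD1 j) //= big1 ?addn0 => [|k kj]; last first.
    apply/eqP; rewrite -leqn0 leqNgt -has_count; apply/hasPn => x /sr[x0 xk].
    apply/negP => /andP[_ xj]; move/eqP: x0; apply.
    move/mximage_idemP: xj => <-; last exact: (spectral_idem specH).
    move/mximage_idemP: xk => <-; last exact: (spectral_idem specH).
    by rewrite mulmxA (spectral_orth normalH specH) ?mul0mx // eq_sym.
  rewrite -(sP j).2; have /eqP -> := orthonormal_free (sP j).1.
  by apply/eqP; rewrite -all_count; apply/allP => x /sr[-> ->].
rewrite mem_cat => /orP[/flatten_mapP[j _ /sr xj]|/t0]; [left|by right].
by exists j.
Qed.

Lemma restrict_eigenvector j (x : 'cV[C]_n) :
  restrict K x != 0 -> restrict K x \in mximage (F j) ->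
  is_eigenvector H (rho j) (restrict K x).
Proof.
by move=> x0; rewrite (spectral_image specH) => /leigenspaceP.
Qed.

Lemma adapted_basis_comm i s : orthonormal_basis (mximage (E i)) s ->
  (forall psi, psi \in s ->
     (exists j, restrict K psi != 0 /\ restrict K psi \in mximage (F j)) \/
     restrict K psi = 0) ->
  H *m Er i = Er i *m H.
Proof.
move=> bs sP.
(* Decompose [E i] along [s] and treat each rank one term separately. *)
rewrite (proj_sum_outer (spectral_idem specM i) (spectral_selfadj specM i) bs).
rewrite restrict_mx_sum mulmx_suml mulmx_sumr big_seq [RHS]big_seq.
apply: eq_bigr => x /sP xP; apply: restrict_outer_comm.
by case: xP => [[j [x0 xj]]|]; [right; exists (rho j); apply: restrict_eigenvector|left].
Qed.

Lemma adapted_basis_cospectral :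
  (forall i, exists s : seq 'cV[C]_n, orthonormal_basis (mximage (E i)) s /\
    forall psi, psi \in s ->
     (exists j, restrict K psi != 0 /\ restrict K psi \in mximage (F j)) \/
     restrict K psi = 0) ->
  cospectral K H M.
Proof.
case/fin_all_exists=> s sP.
have sE i x : x \in s i -> E i *m x = x.
  have [/orthonormal_basisP[_ si] _] := sP i => xs.
  by apply/mximage_idemP; [exact: (spectral_idem specM)|rewrite -si memv_span].
have os i : orthonormal (s i) by have [/orthonormal_basisP[]] := sP i.
exists (flatten [seq s i | i <- enum 'I_d]) => [|x /flatten_mapP[i _ xs]].
  apply/orthonormal_basisP; split.
    apply: orthonormal_flatten => // [|i j ij x y /sE <- /sE <-].
      exact: enum_uniq.
    rewrite cdot_adj (spectral_selfadj specM) mulmxA.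
    by rewrite (spectral_orth normalM specM) // mul0mx cdot0r.
  apply/eqP; rewrite eqEsubv subvf; apply/subvP => v _.
  rewrite -[v]mul1mx -(spectral_sum_proj normalM specM) mulmx_suml.
  apply: memv_suml => i _; have [/orthonormal_basisP[_ si] _] := sP i.
  have /subvP : (<<s i>> <= <<flatten [seq s i | i <- enum 'I_d]>>)%VS.
    by apply: sub_span => x xs; apply/flatten_mapP; exists i; rewrite ?mem_enum.
  by apply; rewrite si; apply/mximageP; exists v.
split.
  exists (theta i); split; first exact: orthonormal_neq0 (os i) xs.
  exact: (spectral_in_eigen specM) (sE _ _ xs).
have [_ /(_ x xs) [[j [x0 xj]]|]] := sP i; last by left.
by right; exists (rho j); apply: restrict_eigenvector.
Qed.

(** Orthogonality passes from the pairs of powers to their spans, one side at a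
    time. *)
Lemma krylov_orth (x y x' y' : 'cV[C]_n) :
  (forall i, cdot (E i *m x) y = 0) ->
  in_krylov M x x' -> in_krylov M y y' -> cdot x' y' = 0.
Proof.
move=> Exy [N xN] [N' yN']; move: y' yN'; apply: cdot_span => _ /mapP[l _ ->].
apply: cdot_eq0C; move: x' xN; apply: cdot_span => _ /mapP[k _ ->].
by apply: cdot_eq0C; apply: (cdot_exp_orth normalM specM).
Qed.

Lemma krylov_self (A : 'M[C]_n) x : in_krylov A x x.
Proof. by exists 1%N; rewrite memv_span // inE expr0 mul1mx. Qed.

Lemma krylov_orth_proj (x y : 'cV[C]_n) :
  (forall x' y', in_krylov M x x' -> in_krylov M y y' -> cdot x' y' = 0) ->
  forall i, cdot (E i *m x) y = 0.
Proof.
move=> orth i; apply: orth (krylov_self _ _).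
exact: (krylov_proj normalM specM).
Qed.

End Equivalences.

Theorem theorem3p3 (R : realType) (n : nat) (K : {set 'I_n})
    (M : 'M[R[i]]_n) (H : 'M[R[i]]_#|K|)
    (d : nat) (theta : 'I_d -> R[i]) (E : 'I_d -> 'M[R[i]]_n)
    (r : nat) (rho : 'I_r -> R[i]) (F : 'I_r -> 'M[R[i]]_#|K|)
    (normalM : M \is normalmx) (normalH : H \is normalmx)
    (specM : spectral_decomposition M theta E)
    (specH : spectral_decomposition H rho F) :
  [<->
    cospectral K H M;
    forall k : nat,
      H *m restrict_mx K (M ^+ k) = restrict_mx K (M ^+ k) *m H;
    forall i, H *m restrict_mx K (E i) = restrict_mx K (E i) *m H;
    forall i j, F j *m restrict_mx K (E i) = restrict_mx K (E i) *m F j;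
    forall (a b : R[i]) (v w : 'cV[R[i]]_#|K|),
      is_eigenvector H a v -> is_eigenvector H b w -> a != b ->
      forall i, cdot (restrict_mx K (E i) *m v) w = 0;
    forall i, exists s : seq 'cV[R[i]]_n,
      [/\ orthonormal_basis (mximage (E i)) s,
          forall j,
            count (fun psi => (restrict K psi != 0) &&
                              (restrict K psi \in mximage (F j))) s
            = \dim (linfun (fun v => E i *m extend K v) @: mximage (F j))%VS
        & forall psi, psi \in s ->
            (exists j, restrict K psi != 0 /\
                       restrict K psi \in mximage (F j)) \/
            restrict K psi = 0];
    forall (a b : R[i]) (v w : 'cV[R[i]]_#|K|),
      is_eigenvector H a v -> is_eigenvector H b w -> a != b ->
      forall x y : 'cV[R[i]]_n,
        in_krylov M (extend K v) x -> in_krylov M (extend K w) y ->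
        cdot x y = 0 ].
Proof.
tfae.
- by move=> cosp k; apply: (cospectral_comm_exp normalH).
- by move=> comm i; apply: (comm_exp_comm_proj normalM specM).
- by move=> comm i; apply/(spectral_commP normalH specH).
- move=> comm a b v w av bw ab i.
  exact: (comm_proj_eigen_orth normalH specH) av bw ab.
- move=> orth i; apply: (adapted_basis normalH specM specH).
  apply: (eigen_orth_comm_proj normalH specH) => a b v w av bw ab.
  exact: orth av bw ab i.
- move=> basis a b v w av bw ab x y; apply: (krylov_orth normalM specM) => i.
  rewrite cdot_restrict_proj; have [s [bs _ sP]] := basis i.
  apply: (comm_proj_eigen_orth normalH specH) av bw ab.
  by apply/(spectral_commP normalH specH); apply: (adapted_basis_comm normalH specM specH) bs sP.
move=> orth; apply: (adapted_basis_cospectral normalM specM specH) => i.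
have [|s [bs _ sP]] := adapted_basis normalH specM specH (i := i); last by exists s.
apply: (eigen_orth_comm_proj normalH specH) => a b v w av bw ab.
rewrite -cdot_restrict_proj; apply: (krylov_orth_proj normalM specM) => x y.
exact: orth av bw ab x y.
Qed.
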